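(* Let $\alpha\in\mathbb{C}$ with $|\alpha|=1$, let $\varphi\in\pi^{-1}\{\alpha\}$, and let $\mathfrak{m}=\ker\varphi$. Then $\mathfrak{m}A^2=A^2$.
   Context: Let $\mathbb{D}=\{z\in\mathbb{C}:|z|<1\}$. $H^\infty$ is the Banach algebra of bounded holomorphic functions on $\mathbb{D}$ with pointwise operations and supremum norm. The Bergman space $A^2$ is the set of all holomorphic $f:\mathbb{D}\to\mathbb{C}$ with $\int_{\mathbb{D}}|f(z)|^2\,dA(z)<\infty$, where $dA$ is the area measure; it is an $H^\infty$-module under pointwise multiplication. $M(H^\infty)$ denotes the maximal ideal space of $H^\infty$, i.e. the set of all nonzero multiplicative (continuous) complex-linear functionals $\varphi:H^\infty\to\mathbb{C}$. Let $\bm{z}\in H^\infty$ be the identity function $\bm{z}(\zeta)=\zeta$ ($\zeta\in\mathbb{D}$), and define $\pi:M(H^\infty)\to\mathbb{C}$ by $\pi(\varphi)=\varphi(\bm{z})$; so $\pi^{-1}\{\alpha\}$ is the set of $\varphi\in M(H^\infty)$ with $\varphi(\bm{z})=\alpha$. For an ideal $\mathfrak{m}$ of $H^\infty$, $\mathfrak{m}A^2:=\{\sum_{i=1}^n r_i m_i: n\in\mathbb{N},\ r_i\in\mathfrak{m},\ m_i\in A^2 \text{ for } 1\le i\le n\}$. *)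

(* Defs.v *)
From HB Require Import structures.
From mathcomp Require Import all_boot all_order all_algebra.
From mathcomp Require Import complex.
From mathcomp Require Import all_classical all_reals all_analysis.

Set Implicit Arguments.
Unset Strict Implicit.
Unset Printing Implicit Defensive.

Import Order.TTheory GRing.Theory Num.Theory.
Import Normc.
Import numFieldNormedType.Exports.

Local Open Scope classical_set_scope.
Local Open Scope complex_scope.
Local Open Scope ring_scope.

(* [R[i]^o], the complex numbers as a normed module over themselves, carries
   the topology of the complex plane. *)
Notation Cplx R := (R[i]^o).

Section Disc.
Variable R : realType.
Local Notation C := (Cplx R).

Definition disc : set C := [set z | `|z| < 1].

(* Functions on the disc have domain exactly [disc]. To speak of derivatives
   and integrals they are extended by 0; as the disc is open, the derivative at
   a point of the disc does not depend on the extension. *)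
Definition ext0 (f : disc -> C) : C -> C := valL_ 0 f.

Lemma ext0E (f : disc -> C) (z : disc) : ext0 f (val z) = f z.
Proof. by rewrite -[LHS]/(sigL disc (valL_ 0 f) z) valLK. Qed.

Lemma ext0_out (f : disc -> C) (z : C) : ~ disc z -> ext0 f z = 0.
Proof. by move=> zd; rewrite /ext0 /valL_ /= oinv_set_val insubF// memNset. Qed.

Lemma ext0_ind (P : C -> C -> Prop) (f : disc -> C) (g : C -> C) :
  (forall z : disc, P (f z) (g (val z))) ->
  (forall z : C, ~ disc z -> P 0 (g z)) ->
  forall z, P (ext0 f z) (g z).
Proof.
move=> Pin Pout z; have [zd|zd] := pselect (disc z).
  by rewrite -[z]/(val (SigSub (mem_set zd))) ext0E; exact: Pin.
by rewrite ext0_out//; exact: Pout.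
Qed.

Lemma ext0D (f g : disc -> C) : ext0 (f + g) = ext0 f + ext0 g.
Proof.
apply/funext; apply: (@ext0_ind eq) => z; rewrite !fctE ?ext0E//.
by move=> zd; rewrite !ext0_out// addr0.
Qed.

Lemma ext0M (f g : disc -> C) : ext0 (f * g) = ext0 f * ext0 g.
Proof.
apply/funext; apply: (@ext0_ind eq) => z; rewrite !fctE ?ext0E//.
by move=> zd; rewrite !ext0_out// mulr0.
Qed.

Lemma ext0Z (k : R[i]) (f : disc -> C) : ext0 (k *: f) = k *: ext0 f.
Proof.
apply/funext; apply: (@ext0_ind eq) => z; rewrite !fctE ?ext0E//.
by move=> zd; rewrite !ext0_out// scaler0.
Qed.

(* Derivability along 1 over the field [R[i]] is complex differentiability. *)
Definition holomorphic (f : disc -> C) : Prop :=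
  forall z : C, disc z -> derivable (ext0 f) z 1.

Lemma disc_near (z : C) : disc z -> \forall w \near z, disc w.
Proof.
move=> zd; apply/nbhs_ballP; exists (1 - `|z|).
  by rewrite /= subr_gt0.
move=> w; rewrite -ball_normE /= /disc /= => zw.
rewrite -(subrK z w) (le_lt_trans (ler_normD _ _))// distrC.
by rewrite -ltrBrDr.
Qed.

Lemma holomorphic_restr (f : C -> C) :
  (forall z, disc z -> derivable f z 1) ->
  holomorphic (fun z : disc => f (val z)).
Proof.
move=> fd z zd; apply: near_eq_derivable (fd z zd).
near=> w; have wd : disc w by near: w; exact: disc_near.
by rewrite -[w in RHS]/(val (SigSub (mem_set wd))) ext0E.
Unshelve. all: by end_near. Qed.

Lemma holomorphicD (f g : disc -> C) :
  holomorphic f -> holomorphic g -> holomorphic (f + g).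
Proof.
by move=> hf hg z zd; rewrite ext0D; apply: derivableD; [exact: hf|exact: hg].
Qed.

Lemma holomorphicM (f g : disc -> C) :
  holomorphic f -> holomorphic g -> holomorphic (f * g).
Proof.
by move=> hf hg z zd; rewrite ext0M; apply: derivableM; [exact: hf|exact: hg].
Qed.

Lemma holomorphicZ (k : R[i]) (f : disc -> C) :
  holomorphic f -> holomorphic (k *: f).
Proof. by move=> hf z zd; rewrite ext0Z; apply: derivableZ; exact: hf. Qed.

(* [normc] is the modulus with values in [R]; [`|z|] has values in [R[i]]. *)
Definition Hinf : set (disc -> C) :=
  [set f | holomorphic f /\ has_ubound (range (fun z => normc (f z)))].

Lemma normcE (z : C) : `|z| = (normc z)%:C.
Proof. by []. Qed.

Lemma holomorphic_cst (k : C) : holomorphic (cst k : disc -> C).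
Proof. by apply: (@holomorphic_restr (cst k)) => z _; exact: derivable_cst. Qed.

Lemma HinfP (f : disc -> C) :
  reflect (holomorphic f /\ exists M, forall z, normc (f z) <= M) (f \in Hinf).
Proof.
apply: (iffP idP) => [/set_mem[hf [M fM]]|[hf [M fM]]].
  by split=> //; exists M => z; apply: fM; exists z.
by apply/mem_set; split=> //; exists M => _ [z _ <-]; exact: fM.
Qed.

Lemma normc_ge0 (z : C) : 0 <= normc z.
Proof. by case: z => a b; exact: sqrtr_ge0. Qed.

Lemma holomorphic_id : holomorphic (fun z : disc => val z).
Proof. by apply: (@holomorphic_restr id) => z _; exact: derivable_id. Qed.

Lemma Hinf_submod : submod_closed (mem Hinf : {pred disc -> C}).
Proof.
split=> [|k f g /HinfP[hf [M fM]] /HinfP[hg [N gN]]]; apply/HinfP.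
  split; first exact: (@holomorphic_cst 0).
  by exists 0 => z; rewrite [normc _](@normc0 R).
split; first exact: (holomorphicD (holomorphicZ hf) hg).
exists (normc k * M + N) => z.
apply: (le_trans (@le_normcD R (k * f z) (g z))).
by rewrite (@normcM R) lerD// ler_wpM2l// normc_ge0.
Qed.

Lemma Hinf_subring : subring_closed (mem Hinf).
Proof.
split=> [|f g fH gH|f g /HinfP[hf [M fM]] /HinfP[hg [N gN]]].
- apply/HinfP; split; first exact: (@holomorphic_cst 1).
  by exists 1 => z; rewrite [normc _](@normc1 R).
- rewrite addrC -scaleN1r; exact: Hinf_submod.2.
- apply/HinfP; split; first exact: (holomorphicM hf hg).
  exists (M * N) => z; rewrite [normc _](@normcM R).
  by apply: ler_pM => //; exact: normc_ge0.
Qed.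

Lemma Hinf_id : (fun z : disc => val z) \in Hinf.
Proof.
apply/HinfP; split; first exact: holomorphic_id.
by exists 1 => -[z zd]; have := set_mem zd; rewrite /disc/= normcE ltcR => /ltW.
Qed.

End Disc.

Arguments disc R : clear implicits.
Arguments Hinf R : clear implicits.

Record Hinfty (R : realType) := MkHinfty {
  Hinfty_fun :> disc R -> Cplx R;
  HinftyP : Hinfty_fun \in Hinf R }.

Section Hinfty_algebra.
Variable R : realType.
Local Notation C := (Cplx R).
Implicit Types f g : Hinfty R.

HB.instance Definition _ := [isSub of Hinfty R for @Hinfty_fun R].
HB.instance Definition _ := [Choice of Hinfty R by <:].
HB.instance Definition _ :=
  GRing.SubChoice_isSubComPzRing.Build _ _ (Hinfty R) (@Hinf_subring R).
HB.instance Definition _ :=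
  GRing.SubZmodule_isSubLmodule.Build _ _ _ (Hinfty R) (@Hinf_submod R).

Definition sup_norm (f : Hinfty R) : R := sup (range (fun z => normc (f z))).

Lemma sup_norm_ub f z : normc (f z) <= sup_norm f.
Proof.
have [_ [M fM]] := set_mem (HinftyP f).
by apply: ub_le_sup; [exists M|exists z].
Qed.

Lemma disc0 : (0 : C) \in disc R.
Proof. by rewrite inE /disc /= normr0. Qed.

Lemma sup_norm_le f M : (forall z, normc (f z) <= M) -> sup_norm f <= M.
Proof.
move=> fM; apply: ge_sup.
  by exists (normc (f (SigSub disc0))), (SigSub disc0).
by move=> _ [z _ <-]; exact: fM.
Qed.

Lemma sup_norm_ge0 f : 0 <= sup_norm f.
Proof. exact: le_trans (normc_ge0 _) (sup_norm_ub f (SigSub disc0)). Qed.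

Lemma sup_norm_ler_normD f g :
  (sup_norm (f + g))%:C <= (sup_norm f)%:C + (sup_norm g)%:C.
Proof.
rewrite -rmorphD lecR; apply: sup_norm_le => z.
by apply: (le_trans (@le_normcD R (f z) (g z))); rewrite lerD// sup_norm_ub.
Qed.

Lemma sup_normZ_le (k : R[i]) f : sup_norm (k *: f) <= normc k * sup_norm f.
Proof.
apply: sup_norm_le => z; rewrite [normc _](@normcM R).
by rewrite ler_wpM2l ?sup_norm_ub// normc_ge0.
Qed.

Lemma sup_norm_normrZ (k : R[i]) f :
  (sup_norm (k *: f))%:C = `|k| * (sup_norm f)%:C.
Proof.
rewrite normcE -rmorphM; congr (_%:C); apply/le_anti.
rewrite sup_normZ_le /=; have [->|k0] := eqVneq k 0.
  by rewrite normc0 mul0r sup_norm_ge0.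
have nk0 : 0 < normc k.
  by rewrite lt_neqAle normc_ge0 andbT eq_sym; apply: contra_neq k0 => /eq0_normc.
have := sup_normZ_le k^-1 (k *: f).
by rewrite scalerA mulVf// scale1r normcV mulrC ler_pdivlMr// mulrC.
Qed.

Lemma sup_norm_normr0_eq0 f : (sup_norm f)%:C = 0 -> f = 0.
Proof.
move=> [f0]; apply/val_inj/funext => z; apply: (@eq0_normc R).
by apply/le_anti; rewrite normc_ge0 -[leRHS]f0 sup_norm_ub.
Qed.

HB.instance Definition _ := Lmodule_isNormed.Build R[i] (Hinfty R)
  sup_norm_ler_normD sup_norm_normrZ sup_norm_normr0_eq0.

Lemma HinftyME f g z : (f * g) z = f z * g z.
Proof. by []. Qed.

Lemma HinftyZE (k : R[i]) f z : (k *: f) z = k * f z.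
Proof. by []. Qed.

Lemma Hinfty_normE f : `|f| = (sup_norm f)%:C.
Proof. by []. Qed.

Definition Hinfty_id : Hinfty R := MkHinfty (@Hinf_id R).

Definition maximal_ideal_space : set (Hinfty R -> C) :=
  [set phi : Hinfty R -> C |
    [/\ scalar phi, {morph phi : f g / f * g}, phi <> cst 0 & continuous phi]].

Definition char_pi (phi : maximal_ideal_space) : C := val phi Hinfty_id.

Definition char_ker (phi : maximal_ideal_space) : set (Hinfty R) :=
  [set f | val phi f = 0].

(* The point (x, y) of [R * R] stands for x + iy, and the product Lebesgue
   measure for the area measure of the plane. *)
Definition Bergman : set (disc R -> C) := [set f | holomorphic f /\
  (\int[@lebesgue_measure R \x @lebesgue_measure R]_(p in
       [set p : R * R | disc R (p.1 +i* p.2)])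
     (normc (ext0 f (p.1 +i* p.2)) ^+ 2)%:E < +oo)%E].

Definition ideal_mul (m : set (Hinfty R)) (A : set (disc R -> C)) :
    set (disc R -> C) :=
  [set f | exists n (r : 'I_n -> Hinfty R) (a : 'I_n -> disc R -> C),
    [/\ forall i, m (r i), forall i, A (a i)
      & f = fun z => \sum_(i < n) r i z * a i z]].

End Hinfty_algebra.

Arguments Bergman R : clear implicits.
Arguments maximal_ideal_space R : clear implicits.

(* Main.v *)
Require Import Defs.
From mathcomp Require Import all_boot all_order all_algebra.
From mathcomp Require Import complex.
From mathcomp Require Import all_classical all_reals all_analysis.
From mathcomp Require Import measurable_realfun.
From mathcomp Require Import ring lra.

Import Order.TTheory GRing.Theory Num.Theory.
Import Normc.
Import numFieldNormedType.Exports.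

Local Open Scope classical_set_scope.
Local Open Scope ring_scope.

Set Implicit Arguments.
Unset Strict Implicit.
Unset Printing Implicit Defensive.

(** The inclusion of [ideal_mul (char_ker phi) (Bergman R)] in [Bergman R] holds
because bounded functions multiply the Bergman space into itself and the
Bergman space is closed under sums. The content is the converse: every [f] in
the Bergman space is a single product [r * a] with [phi r = 0].

In the coordinate [u = 1 - conj(alpha) z] the disc lies in the half-plane
[Re u > 0] and [alpha] becomes [0]. The kernels [e / (e + u)], [e > 0], are
bounded by 1, have nonnegative real part, equal 1 at [u = 0], and tend to 0
away from [u = 0] as [e] tends to 0. They enter twice.

Factorization, in the spirit of Cohen's theorem. By dominated convergence the
integral of [|f|^2 |e / (e + u)|] tends to 0 with [e], so one can pick a
summable sequence [e_k] along which it is as small as desired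
([small_peak_weight]). Put [h = 1 + sum_k e_k / (e_k + u)]. This is holomorphic
([derivable_multiplier]); [Re h >= 1], and each kernel with [e_k >= |u|] adds at
least 1/4, so [h] tends to infinity at [alpha] ([Re_multiplier_near]). As the
kernels have modulus at most 1, [|h|^2] is dominated by a weighted sum of their
moduli to the first power ([multiplier_sqr_le]), which the choice of the [e_k]
makes integrable against [|f|^2]: thus [h f] is in the Bergman space
([Bergman_multiplier]), and [f = h^-1 * (h f)] with [h^-1] bounded by 1 and
tending to 0 at [alpha].

Characters over [alpha]. Such a [phi] takes the value 1 on every kernel, because
it kills [u] ([character_peak]). If a bounded [r] tends to 0 at [alpha], then
[r * (e / (e + u))] tends to 0 in norm with [e], while [phi] maps it to [phi r]
for every [e]; continuity gives [phi r = 0] ([character_eq0]). Applied to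
[r = h^-1] this puts [r] in the kernel of [phi]. *)

(** * Absolutely convergent complex series *)

Section ComplexSeries.
Variable R : realType.
Local Notation C := (Cplx R).
Local Notation Re := (@complex.Re R).
Local Notation Im := (@complex.Im R).
Implicit Types (a b : nat -> C) (z w : C).

Lemma ler_Re_normc z : `|Re z| <= normc z.
Proof. by have := normc_ge_Re z; rewrite Defs.normcE lecR. Qed.

Lemma ler_Im_normc z : `|Im z| <= normc z.
Proof.
have := ler_Re_normc (z * 'i%C).
rewrite ReiNIm normrN [normc _](@normcM R) [X in _ * X]/normc.
by rewrite expr0n expr1n add0r sqrtr1 mulr1.
Qed.

Lemma ler_normc_ReIm z : normc z <= `|Re z| + `|Im z|.
Proof.
case: z => x y /=; rewrite -[leRHS]ger0_norm ?addr_ge0// -sqrtr_sqr ler_wsqrtr//.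
rewrite sqrrD !real_normK ?num_real// addrAC lerDl.
by rewrite mulrn_wge0// mulr_ge0.
Qed.

Lemma normcB z w : normc (z - w) = normc (w - z).
Proof. by rewrite -[in RHS](opprB z w) [RHS](@normcN R). Qed.

Definition summable_seq a := cvgn (series (fun k => normc (a k) : R)).

(** Summed coordinatewise, so that convergence is that of two real series. *)
Definition csum a : C :=
  (limn (series (Re \o a)) +i* limn (series (Im \o a)))%C.

Lemma summable_Re a : summable_seq a -> cvgn [normed series (Re \o a)].
Proof.
by apply: series_le_cvg => n;
  [exact: normr_ge0|exact: normc_ge0|exact: ler_Re_normc].
Qed.

Lemma summable_Im a : summable_seq a -> cvgn [normed series (Im \o a)].
Proof.
by apply: series_le_cvg => n;
  [exact: normr_ge0|exact: normc_ge0|exact: ler_Im_normc].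
Qed.

Lemma summable_le a (g : nat -> R) : (forall k, normc (a k) <= g k) ->
  cvgn (series g) -> summable_seq a.
Proof.
move=> ag; apply: series_le_cvg => // n; first exact: normc_ge0.
exact: le_trans (normc_ge0 _) (ag n).
Qed.

(** The factor 2 comes from bounding the modulus by the sum of the absolute
    values of the two coordinates. *)
Lemma csum_normc a : summable_seq a ->
  normc (csum a) <= 2 * limn (series (fun k => normc (a k))).
Proof.
move=> sa; apply: (le_trans (ler_normc_ReIm _)) => /=.
rewrite mulr_natl mulr2n lerD//.
- apply: (le_trans (lim_series_norm (summable_Re sa))).
  by apply: lim_series_le => //; [exact: summable_Re|move=> n; exact: ler_Re_normc].
- apply: (le_trans (lim_series_norm (summable_Im sa))).
  by apply: lim_series_le => //; [exact: summable_Im|move=> n; exact: ler_Im_normc].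
Qed.

Lemma csumB a b : summable_seq a -> summable_seq b ->
  csum (a - b) = csum a - csum b.
Proof.
move=> sa sb; rewrite /csum.
have -> : Re \o (a - b) = (Re \o a) - (Re \o b).
  by apply/funext => k; rewrite !fctE /=; case: (a k) (b k) => [? ?] [].
have -> : Im \o (a - b) = (Im \o a) - (Im \o b).
  by apply/funext => k; rewrite !fctE /=; case: (a k) (b k) => [? ?] [].
rewrite (lim_seriesB (normed_cvg (summable_Re sa))
  (normed_cvg (summable_Re sb))).
by rewrite (lim_seriesB (normed_cvg (summable_Im sa))
  (normed_cvg (summable_Im sb))).
Qed.

Lemma csumZ a z : summable_seq a -> csum (fun k => z * a k) = z * csum a.
Proof.
move=> sa; rewrite /csum; case: z => x y.
have cR := normed_cvg (summable_Re sa); have cI := normed_cvg (summable_Im sa).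
have -> : Re \o (fun k => (x +i* y)%C * a k) =
    (x *: (Re \o a)) - (y *: (Im \o a)).
  by apply/funext => k; rewrite !fctE /=; case: (a k).
have -> : Im \o (fun k => (x +i* y)%C * a k) =
    (x *: (Im \o a)) + (y *: (Re \o a)).
  by apply/funext => k; rewrite !fctE /=; case: (a k).
rewrite (lim_seriesB (is_cvg_seriesZ cR) (is_cvg_seriesZ cI)).
rewrite (lim_seriesD (is_cvg_seriesZ cI) (is_cvg_seriesZ cR)).
by rewrite !lim_seriesZ.
Qed.

(** For terms with nonnegative real part the real parts of the partial sums
    increase to that of the sum. *)
Lemma csum_Re_ge a n : summable_seq a -> (forall k, 0 <= Re (a k)) ->
  \sum_(k < n) Re (a k) <= Re (csum a).
Proof.
move=> sa a0 /=.
have -> : \sum_(k < n) Re (a k) = series (Re \o a) n.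
  by rewrite /series /= big_mkord.
apply: nondecreasing_cvgn_le; last exact/normed_cvg/summable_Re.
by apply: nondecreasing_series => k _ _; exact: a0.
Qed.

End ComplexSeries.

(** * The kernels e / (e + u) on the right half-plane *)

(** A second order Taylor bound exhibits the derivative: the difference quotient
    differs from [d] by at most [K] times the increment. *)
Lemma derivable_quadratic (F : numFieldType) (f : F^o -> F^o) (v d : F^o)
    (K r : F) : 0 <= K -> 0 < r ->
  (forall w, `|w - v| < r ->
    `|f w - f v - (w - v) * d| <= K * `|w - v| ^+ 2) ->
  derivable f v 1.
Proof.
move=> Kge0 r0 H; apply/cvg_ex; exists d; apply/cvgrPdist_lt => /= e e0.
pose K1 := K + 1; have K10 : 0 < K1 by rewrite ltr_wpDl.
near=> h.
have h0 : h != 0 by near: h; exact: nbhs_dnbhs_neq.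
have hr : `|h| < r by near: h; exact: dnbhs0_lt.
have hK : `|h| < e / K1 by near: h; apply: dnbhs0_lt; rewrite divr_gt0.
have hE : h *: (1 : F^o) = h := mulr1 h.
rewrite distrC; have := H (h *: 1 + v); rewrite addrK hE => /(_ hr).
set w := _ + v; set D := f w - f v - _ => HD.
have -> : h^-1 *: (f w - f v) - d = h^-1 * D.
  by rewrite /D mulrBr mulrA mulVf// mul1r.
rewrite normrM normfV mulrC ltr_pdivrMr ?normr_gt0//.
apply: (le_lt_trans HD); rewrite expr2 mulrA ltr_pM2r ?normr_gt0//.
rewrite ltr_pdivlMr// mulrC in hK.
apply: le_lt_trans hK; rewrite ler_wpM2r//.
by rewrite lerDl.
Unshelve. all: by end_near. Qed.

Section CauchyKernel.
Variable R : realType.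
Local Notation C := (Cplx R).
Local Notation Re := (@complex.Re R).
Implicit Types (u v w : C) (e : R).

(** A Cauchy kernel normalized to be 1 at [u = 0]; on the right half-plane it
    peaks there, more and more sharply as [e] decreases. *)
Definition peak e u : C := (e%:C)%C / ((e%:C)%C + u).

Lemma normc_real e : 0 <= e -> normc (e%:C)%C = e.
Proof. by move=> e0; rewrite /= expr0n addr0 sqrtr_sqr ger0_norm. Qed.

Lemma ReD u v : Re (u + v) = Re u + Re v.
Proof. by case: u v => [? ?] []. Qed.

Lemma ler_Re u : Re u <= normc u.
Proof. exact: le_trans (ler_norm _) (ler_Re_normc _). Qed.

Lemma normc_addr_ge e u : 0 <= e -> 0 <= Re u -> normc u <= normc ((e%:C)%C + u).
Proof.
case: u => x y /= e0 x0; rewrite add0r ler_wsqrtr// lerD2r ler_sqr ?nnegrE ?addr_ge0//.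
by rewrite lerDr.
Qed.

Lemma normc_addl_ge e u : 0 <= Re u -> e <= normc ((e%:C)%C + u).
Proof.
by move=> x0; apply: le_trans (ler_Re _); rewrite ReD /= lerDl.
Qed.

Lemma addc_neq0 e u : 0 <= e -> 0 < Re u -> (e%:C)%C + u != 0.
Proof.
move=> e0 x0; apply/eqP => /(congr1 Re); rewrite ReD /= => h.
by move: (ltr_wpDl e0 x0); rewrite h ltxx.
Qed.

Lemma normc_peak e u : 0 <= e -> normc (peak e u) = e / normc ((e%:C)%C + u).
Proof. by move=> e0; rewrite [LHS](@normcM R) (@normcV R) normc_real. Qed.

Lemma peak_le1 e u : 0 < e -> 0 <= Re u -> normc (peak e u) <= 1.
Proof.
move=> e0 u0; rewrite (normc_peak _ (ltW e0)) ler_pdivrMr ?mul1r ?normc_addl_ge//.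
exact: lt_le_trans (normc_addl_ge _ u0).
Qed.

Lemma peak_le e u : 0 <= e -> 0 < Re u -> normc (peak e u) <= e / normc u.
Proof.
move=> e0 u0; have nu : 0 < normc u := lt_le_trans u0 (ler_Re _).
have h := normc_addr_ge e0 (ltW u0).
by rewrite normc_peak// ler_wpM2l// lef_pV2 ?posrE// (lt_le_trans nu).
Qed.

Lemma Re_peak e u : Re (peak e u) = e * (e + Re u) / normc ((e%:C)%C + u) ^+ 2.
Proof.
case: u => x y; rewrite /peak /= !add0r !mul0r subr0 sqr_sqrtr ?addr_ge0 ?sqr_ge0//.
by rewrite mulrA.
Qed.

Lemma peak_Re_ge0 e u : 0 <= e -> 0 <= Re u -> 0 <= Re (peak e u).
Proof.
by move=> e0 u0; rewrite Re_peak divr_ge0 ?sqr_ge0// mulr_ge0// addr_ge0.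
Qed.

(** The value at [u = 0] is 1, and on the half-disc of radius [e] the
    denominator has modulus at most [2 * e], which costs a factor 4. *)
Lemma peak_Re_near e u : 0 < e -> 0 <= Re u -> normc u <= e ->
  4^-1 <= Re (peak e u).
Proof.
move=> e0 u0 ue; rewrite Re_peak.
have := normc_addl_ge e u0; have : normc ((e%:C)%C + u) <= e + e.
  by apply: (le_trans (@le_normcD R _ _)); rewrite (normc_real (ltW e0)) lerD2l.
move: (normc _) => N N2 eN; have N0 := lt_le_trans e0 eN.
rewrite ler_pdivlMr ?exprn_gt0//; nra.
Qed.

Lemma derivable_quadratic_normc (f : C -> C) v (d : C) (K r : R) : 0 <= K -> 0 < r ->
  (forall w, normc (w - v) < r ->
    normc (f w - f v - (w - v) * d) <= K * normc (w - v) ^+ 2) ->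
  derivable f v 1.
Proof.
move=> K0 r0 H; apply: (@derivable_quadratic _ f v d (K%:C)%C (r%:C)%C).
- by rewrite lecR.
- by rewrite ltcR.
move=> w; rewrite !Defs.normcE ltcR => /H.
by rewrite -rmorphXn -rmorphM lecR.
Qed.

End CauchyKernel.

(** * Holomorphy of the series of kernels *)

Section PeakSeries.
Variables (R : realType) (eps : nat -> R).
Local Notation C := (Cplx R).
Local Notation Re := (@complex.Re R).
Hypothesis eps_gt0 : forall k, 0 < eps k.
Hypothesis eps_cvg : cvgn (series eps).
Implicit Types (u v w : C).

Let is_cvg_eps (c : R) : cvgn (series (fun k => c * eps k)).
Proof. exact: (@is_cvg_seriesZ _ _ c eps_cvg). Qed.

Definition peak_sum u : C := csum (fun k => peak (eps k) u).

Lemma summable_peak u : 0 < Re u -> summable_seq (fun k => peak (eps k) u).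
Proof.
move=> u0; apply: (@summable_le _ _ (fun k => (normc u)^-1 * eps k)) => [k|].
  by rewrite mulrC; apply: peak_le => //; exact: ltW.
exact: is_cvg_eps.
Qed.

(** The exact second order Taylor remainder of the kernel: it carries a factor
    [e], which makes the remainders summable over the scales. *)
Lemma peak_taylor (F : fieldType) (e v w : F) : e + v != 0 -> e + w != 0 ->
  e / (e + w) - e / (e + v) - (w - v) * (- (e / (e + v) ^+ 2)) =
  (w - v) ^+ 2 * (e / ((e + w) * (e + v) ^+ 2)).
Proof. by move=> ? ?; field; apply/andP. Qed.

(** The term-by-term derivative is the derivative: summing the Taylor remainders
    of the kernels gives a bound quadratic in the increment. *)
Lemma derivable_peak_sum v : 0 < Re v -> derivable peak_sum v 1.
Proof.
move=> v0; pose r := Re v / 2; have r0 : 0 < r by rewrite divr_gt0.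
have rv : r <= Re v by rewrite /r; lra.
(* On the half-plane [r <= Re u] all denominators have modulus at least [r]. *)
have big k u : r <= Re u -> r <= normc ((eps k)%:C%C + u).
  move=> ru; apply: (le_trans ru); apply: le_trans (ler_Re _).
  by rewrite ReD /= lerDr ltW.
pose d k : C := - ((eps k)%:C%C / ((eps k)%:C%C + v) ^+ 2).
pose q w k : C := (eps k)%:C%C / (((eps k)%:C%C + w) * ((eps k)%:C%C + v) ^+ 2).
have normq w k : r <= Re w -> normc (q w k) <= r ^- 3 * eps k.
  move=> rw; rewrite /q [normc _](@normcM R) (@normcV R) normc_real; last exact: ltW.
  rewrite mulrC ler_wpM2r//; first exact: ltW.
  rewrite (@normcM R) expr2 (@normcM R) -expr2.
  have bw := big k w rw; have bv := big k v rv.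
  have bw0 := lt_le_trans r0 bw; have bv0 := lt_le_trans r0 bv.
  rewrite lef_pV2 ?posrE ?mulr_gt0 ?exprn_gt0// exprS.
  apply: ler_pM => //; [exact: ltW|exact: sqr_ge0|].
  by rewrite ler_sqr ?nnegrE ?normc_ge0// ltW.
have sumq w : r <= Re w -> summable_seq (q w).
  move=> rw; apply: (@summable_le _ _ (fun k => r ^- 3 * eps k)) => [k|].
    exact: normq.
  exact: is_cvg_eps.
have sumd : summable_seq d.
  apply: (@summable_le _ _ (fun k => r ^- 2 * eps k)) => [k|]; last exact: is_cvg_eps.
  rewrite /d [normc _](@normcN R) (@normcM R) (@normcV R) normc_real; last exact: ltW.
  rewrite mulrC ler_wpM2r//; first exact: ltW.
  have bv := big k v rv.
  have bv0 := lt_le_trans r0 bv.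
  rewrite expr2 (@normcM R) -expr2 lef_pV2 ?posrE ?exprn_gt0//.
  by rewrite ler_sqr ?nnegrE ?normc_ge0// ltW.
pose K := 2 * limn (series (fun k => r ^- 3 * eps k)).
apply: (@derivable_quadratic_normc _ _ _ (csum d) K r) => //.
  rewrite /K mulr_ge0//; apply: limr_ge; first exact: is_cvg_eps.
  near=> n; apply: sumr_ge0 => k _.
  by rewrite mulr_ge0 ?invr_ge0 ?exprn_ge0 ?(ltW r0) ?(ltW (eps_gt0 _)).
move=> w wv.
have rw : r <= Re w.
  have : `|Re (w - v)| < r by exact: le_lt_trans (ler_Re_normc _) wv.
  have -> : Re (w - v) = Re w - Re v by case: (w) (v) => [? ?] [].
  by rewrite ltr_norml => /andP[+ _]; rewrite /r; lra.
have w0 := lt_le_trans r0 rw.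
have -> : peak_sum w - peak_sum v - (w - v) * csum d = (w - v) ^+ 2 * csum (q w).
  have <- := csumZ ((w - v) ^+ 2) (sumq w rw).
  have <- := csumZ (w - v) sumd.
  have <- := csumB (summable_peak w0) (summable_peak v0).
  rewrite -csumB.
  - congr csum; apply/funext => k; rewrite !fctE /peak /d /q.
    by apply: (@peak_taylor C); apply: addc_neq0 => //; exact: ltW.
  - apply: (@summable_le _ _ ((fun k => normc (peak (eps k) w)) +
      (fun k => normc (peak (eps k) v)))) => [k|].
      by apply: (le_trans (@le_normcD R _ _)); rewrite (@normcN R).
    by apply: is_cvg_seriesD; exact: summable_peak.
  - apply: (@summable_le _ _ (normc (w - v) *: (fun k => normc (d k)))) => [k|].
      by rewrite (@normcM R).
    exact: is_cvg_seriesZ.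
rewrite [normc _](@normcM R) expr2 (@normcM R) -expr2 mulrC ler_wpM2r ?sqr_ge0//.
apply: (le_trans (csum_normc (sumq _ rw))); rewrite ler_pM2l//.
by apply: lim_series_le; [exact: sumq|exact: is_cvg_eps|move=> k; exact: normq].
Unshelve. all: by end_near. Qed.
End PeakSeries.

(** * The multiplier 1 + sum_k e_k / (e_k + u) *)

Section Multiplier.
Variables (R : realType) (eps : nat -> R).
Local Notation C := (Cplx R).
Local Notation Re := (@complex.Re R).
Hypothesis eps_gt0 : forall k, 0 < eps k.
Hypothesis eps_cvg : cvgn (series eps).
Implicit Types (u v w : C).

Definition multiplier u : C := 1 + peak_sum eps u.

Lemma derivable_multiplier v : 0 < Re v -> derivable multiplier v 1.
Proof.
move=> v0; rewrite (_ : multiplier = cst 1 + peak_sum eps)//.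
by apply: derivableD; [exact: derivable_cst|exact: derivable_peak_sum].
Qed.

(** Why the multiplier is unbounded near [u = 0]: the kernels whose scale
    exceeds [normc u] contribute at least 1/4 each, and the others cannot
    compensate as all real parts are nonnegative. *)
Lemma Re_multiplier_near m u : 0 < Re u ->
  (forall k, (k < m)%N -> normc u <= eps k) ->
  1 + m%:R / 4 <= Re (multiplier u).
Proof.
move=> u0 um; rewrite ReD lerD2l.
have pge0 k : 0 <= Re (peak (eps k) u) by rewrite peak_Re_ge0// ltW.
apply: le_trans (csum_Re_ge m (summable_peak eps_gt0 eps_cvg u0) pge0).
rewrite mulrC mulr_natr -[in leLHS](card_ord m) -sumr_const ler_sum// => k _.
by apply: peak_Re_near => //; [exact: ltW|exact: um].
Qed.

Lemma Re_multiplier_ge1 u : 0 < Re u -> 1 <= Re (multiplier u).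
Proof.
by move=> u0; have := @Re_multiplier_near 0 u u0; rewrite mul0r addr0; exact.
Qed.

(** Squares of sums become sums of first powers: expanding the square, a product
    of two terms is at most the one with the larger index since both are in
    [0, 1], and counting these products (1 being a term too) gives the weights
    [2 * k + 3]. *)
Lemma sqr_sum_le (x : nat -> R) n : (forall k, 0 <= x k <= 1) ->
  (1 + series x n) ^+ 2 <= 1 + \sum_(k < n) (2 * k + 3)%:R * x k.
Proof.
move=> x01; have Sn m : series x m <= m%:R.
  rewrite /series /= big_mkord -[in leRHS](card_ord m) -sumr_const.
  rewrite ler_sum// => k _.
  by case/andP: (x01 k).
elim: n => [|n IH]; first by rewrite /series /= big_geq// big_ord0 !addr0 expr1n.
rewrite big_ord_recr /= seriesSr addrA.
have := x01 n; have := Sn n; move: (series x n) (x n) IH => s y.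
move: (bigop _ _ _) => T; rewrite natrD natrM => IH sn /andP[y0 y1]; nra.
Qed.

(** Stated in the extended reals so that the right side can be integrated term
    by term. *)
Lemma multiplier_sqr_le u : 0 < Re u ->
  ((normc (multiplier u) ^+ 2)%:E <= 4%:E *
    (1 + \sum_(k <oo) ((2 * k + 3)%:R * normc (peak (eps k) u))%:E))%E.
Proof.
move=> u0; pose x k : R := normc (peak (eps k) u).
have x01 k : 0 <= x k <= 1 by rewrite normc_ge0/= peak_le1// ltW.
have cx : cvgn (series x) := summable_peak eps_gt0 eps_cvg u0.
pose X := limn (series x).
have X0 : 0 <= X.
  apply: limr_ge => //; near=> n; apply: sumr_ge0 => k _.
  by case/andP: (x01 k).
have mX : normc (multiplier u) ^+ 2 <= 4 * (1 + X) ^+ 2.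
  have : normc (multiplier u) <= 2 * (1 + X).
    apply: (le_trans (@le_normcD R _ _)); rewrite (@normc1 R) mulrDr mulr1 lerD//.
      by rewrite ler1n.
    exact: csum_normc (summable_peak eps_gt0 eps_cvg u0).
  move=> le2; have -> : 4 * (1 + X) ^+ 2 = (2 * (1 + X)) ^+ 2 by ring.
  by apply: ler_pM; rewrite ?normc_ge0.
apply: (@le_trans _ _ (4%:E * ((1 + X) ^+ 2)%:E)%E).
  by rewrite -EFinM lee_fin.
rewrite lee_pmul2l// -/x.
have cS : (((1 + series x n) ^+ 2)%:E @[n --> \oo] --> ((1 + X) ^+ 2)%:E)%E.
  apply: cvg_EFin; first by near=> n.
  have c1 : 1 + series x n @[n --> \oo] --> 1 + X.
    by apply: cvgD => //; exact: cvg_cst.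
  exact: (cvgM c1 c1).
apply: (cvge_to_le cS); near=> n.
apply: (@le_trans _ _ (1 + \sum_(k < n) (2 * k + 3)%:R * x k)%:E).
  by rewrite lee_fin; exact: sqr_sum_le.
rewrite EFinD leeD2l// -sumEFin.
rewrite -(big_mkord xpredT (fun k => ((2 * k + 3)%:R * x k)%:E)).
apply: nneseries_lim_ge => k _ _; rewrite lee_fin mulr_ge0//.
by case/andP: (x01 k).
Unshelve. all: by end_near. Qed.

End Multiplier.

(** * Measurability of the modulus of a holomorphic function *)

Lemma derivable_dist (F : numFieldType) (f : F^o -> F^o) (z e : F) :
  derivable f z 1 -> 0 < e ->
  exists2 s : F, 0 < s & forall w, `|w - z| < s -> `|f w - f z| < e.
Proof.
move=> /derivable1_diffP/differentiable_continuous cf e0.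
move/cvgrPdist_lt: cf => /(_ e e0) /nbhs_ballP[s /= s0 Hs].
exists s => // w wz; rewrite distrC; apply: Hs.
by rewrite -ball_normE /= distrC.
Qed.

Section PlaneMeasurability.
Variable R : realType.
Local Notation C := (Cplx R).
Local Notation plane := (measurableTypeR R * measurableTypeR R)%type.

(** The product sigma-algebra is generated by rectangles, while openness gives
    squares around each point; squares with rational centre and radius reduce the
    union to a countable one. *)
Lemma open_plane_measurable (O : set plane) :
  (forall p, O p -> exists2 e : R, 0 < e & forall q : plane,
     `|q.1 - p.1| < e -> `|q.2 - p.2| < e -> O q) -> measurable O.
Proof.
move=> Oopen.
pose box (t : rat * rat * rat) : set plane :=
  `]ratr t.1.1 - ratr t.2, ratr t.1.1 + ratr t.2[%classic `*`
  `]ratr t.1.2 - ratr t.2, ratr t.1.2 + ratr t.2[%classic.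
have -> : O = \bigcup_(t in [set t | box t `<=` O]) box t.
  apply/seteqP; split=> [p Op|p [t tO] tp]; last exact: tO.
  have [e e0 He] := Oopen p Op.
  have [r] := @rat_in_itvoo R 0 (e / 2) (divr_gt0 e0 (ltr0n _ 2)).
  rewrite in_itv/= => /andP[r0 re].
  have [a] := @rat_in_itvoo R (p.1 - ratr r) (p.1 + ratr r) ltac:(lra).
  have [b] := @rat_in_itvoo R (p.2 - ratr r) (p.2 + ratr r) ltac:(lra).
  rewrite !in_itv/= => /andP[b1 b2] /andP[a1 a2].
  exists (a, b, r).
    move=> q [/=]; rewrite !in_itv/= => /andP[q1 q2] /andP[q3 q4].
    by apply: He; rewrite ltr_norml; apply/andP; split; lra.
  by split; rewrite /= in_itv/=; apply/andP; split; lra.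
rewrite bigcup_mkcond; apply: countable_bigcupT_measurable => // t.
case: ifPn => // _; apply: measurableX; exact: measurable_itv.
Qed.

Definition plane_disc : set plane := [set p | disc R (p.1 +i* p.2)%C].

Lemma cplxB (p q : plane) :
  (q.1 +i* q.2)%C - (p.1 +i* p.2)%C = ((q.1 - p.1) +i* (q.2 - p.2))%C.
Proof. by []. Qed.

(** Continuity together with openness of the disc, in terms of the real-valued
    modulus. *)
Lemma holomorphic_dist (f : disc R -> C) (z : C) (e : R) :
  holomorphic f -> disc R z -> 0 < e ->
  exists2 s : R, 0 < s & forall w : C, normc (w - z) < s ->
    disc R w /\ normc (ext0 f w - ext0 f z) < e.
Proof.
move=> hf zd e0.
have e0' : 0 < (e%:C)%C :> R[i] by rewrite ltcR.
have [s + Hs] := derivable_dist (hf z zd) e0'.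
rewrite ltcE /= => /andP[/eqP Ims s0].
have z1 : 0 < 1 - normc z by move: zd; rewrite /disc /= Defs.normcE ltcR subr_gt0.
exists (Num.min (complex.Re s) (1 - normc z)); first by rewrite lt_min s0.
move=> w; rewrite lt_min => /andP[ws wz]; split.
  rewrite /disc /= Defs.normcE ltcR -(subrK z w).
  by apply: (le_lt_trans (@le_normcD R _ _)); rewrite -ltrBrDr.
rewrite -ltcR; apply: Hs; rewrite Defs.normcE ltcE /= Ims eqxx /=.
exact: ws.
Qed.

Lemma ler_normc_coord (p q : plane) (d : R) :
  `|q.1 - p.1| < d / 2 -> `|q.2 - p.2| < d / 2 ->
  normc ((q.1 +i* q.2)%C - (p.1 +i* p.2)%C : C) < d.
Proof.
move=> h1 h2; rewrite cplxB; apply: (le_lt_trans (ler_normc_ReIm _)) => /=; lra.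
Qed.

Lemma measurable_plane_disc : measurable plane_disc.
Proof.
apply: open_plane_measurable => p pd.
have [s s0 Hs] := holomorphic_dist (@holomorphic_id R) pd ltr01.
exists (s / 2); first by rewrite divr_gt0.
by move=> q q1 q2; have [] := Hs _ (ler_normc_coord q1 q2).
Qed.

Lemma measurable_normc_holomorphic (f : disc R -> C) : holomorphic f ->
  measurable_fun plane_disc (fun p => normc (ext0 f (p.1 +i* p.2)%C) : R).
Proof.
move=> hf; apply: (measurability _ (RGenOInfty.measurableE R)).
move=> _ [_ [a ->] <-]; apply: open_plane_measurable => p [pd] /=.
rewrite in_itv /= andbT => ap.
have e0 : 0 < normc (ext0 f (p.1 +i* p.2)%C) - a by rewrite subr_gt0.
have [s s0 Hs] := holomorphic_dist hf pd e0.
exists (s / 2); first by rewrite divr_gt0.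
move=> q q1 q2; have [qd fq] := Hs _ (ler_normc_coord q1 q2).
split=> //=; rewrite in_itv /= andbT.
have := @le_normcD R (ext0 f (q.1 +i* q.2)%C)
  (ext0 f (p.1 +i* p.2)%C - ext0 f (q.1 +i* q.2)%C).
rewrite addrC subrK normcB; lra.
Qed.

End PlaneMeasurability.

(** * Closure properties of the Bergman space *)

Section BergmanSpace.
Variable R : realType.
Local Notation C := (Cplx R).
Local Notation plane := (measurableTypeR R * measurableTypeR R)%type.
Local Notation mu := (@lebesgue_measure R \x @lebesgue_measure R)%E.
Local Notation D := (@plane_disc R).
Implicit Types f g : disc R -> C.

Definition sqnorm f (p : plane) : R := normc (ext0 f (p.1 +i* p.2)%C) ^+ 2.

Lemma plane_discP p : D p -> exists z : disc R, val z = (p.1 +i* p.2)%C.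
Proof.
by move=> pd; exists (SigSub (mem_set (pd : disc R (p.1 +i* p.2)%C))).
Qed.

Lemma measurable_sqnorm f : holomorphic f ->
  measurable_fun D (fun p => (sqnorm f p)%:E).
Proof.
move=> hf; apply/measurable_EFinP; apply: measurable_funX.
exact: measurable_normc_holomorphic.
Qed.

Lemma sqnorm_ge0 f p : (0 <= (sqnorm f p)%:E)%E.
Proof. by rewrite lee_fin sqr_ge0. Qed.

Lemma Bergman_dominated f (W : plane -> \bar R) : holomorphic f ->
  measurable_fun D W -> (\int[mu]_(p in D) W p < +oo)%E ->
  (forall p, D p -> ((sqnorm f p)%:E <= W p)%E) -> Bergman R f.
Proof.
move=> hf mW iW fW; split=> //; apply: le_lt_trans iW.
apply: ge0_le_integral => //.
- exact: measurable_plane_disc.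
- by move=> p _; exact: sqnorm_ge0.
- exact: measurable_sqnorm.
Qed.

(** From [|x + y|^2 <= 2 (|x|^2 + |y|^2)]. *)
Lemma BergmanD f g : Bergman R f -> Bergman R g -> Bergman R (f + g).
Proof.
move=> [hf If] [hg Ig].
have mD := @measurable_plane_disc R.
have msf := measurable_sqnorm hf; have msg := measurable_sqnorm hg.
apply: (@Bergman_dominated _
  (fun p => 2%:E * ((sqnorm f p)%:E + (sqnorm g p)%:E))%E).
- exact: holomorphicD.
- by apply: measurable_funeM; exact: emeasurable_funD.
- rewrite ge0_integralZl//; last 2 first.
    exact: emeasurable_funD.
    by move=> p _; rewrite adde_ge0 ?sqnorm_ge0.
  rewrite ge0_integralD//; try by move=> p _; exact: sqnorm_ge0.
  by rewrite lte_mul_pinfty// lte_add_pinfty.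
- move=> p _; rewrite -EFinD -EFinM lee_fin /sqnorm ext0D fctE.
  set x := ext0 f _; set y := ext0 g _.
  have := @le_normcD R x y; have := @normc_ge0 R (x + y).
  have := sqr_ge0 (normc x - normc y).
  rewrite -/x -/y; move: (normc x) (normc y) (normc (x + y)) => a b c; nra.
Qed.

Lemma Bergman_le f g (M : R) : holomorphic f -> Bergman R g ->
  (forall z, normc (f z) <= M * normc (g z)) -> Bergman R f.
Proof.
move=> hf [hg Ig] fg.
have mD := @measurable_plane_disc R.
apply: (@Bergman_dominated _ (fun p => (M ^+ 2)%:E * (sqnorm g p)%:E)%E) => //.
- by apply: measurable_funeM; exact: measurable_sqnorm.
- rewrite ge0_integralZl//; last 3 first.
    exact: measurable_sqnorm.
    by move=> p _; exact: sqnorm_ge0.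
    by rewrite lee_fin sqr_ge0.
  by rewrite lte_mul_pinfty// lee_fin sqr_ge0.
- move=> p /plane_discP[z zE].
  rewrite -EFinM lee_fin /sqnorm -exprMn -zE !ext0E.
  by apply: ler_pM; rewrite ?normc_ge0.
Qed.

Lemma BergmanM (r : Hinfty R) f : Bergman R f -> Bergman R (fun z => r z * f z).
Proof.
move=> Bf; have [hr [M rM]] := set_mem (HinftyP r).
have hrf : holomorphic (fun z => r z * f z) by exact: holomorphicM hr Bf.1.
apply: (Bergman_le (M := M) hrf Bf) => z.
by rewrite (@normcM R) ler_wpM2r ?normc_ge0//; apply: rM; exists z.
Qed.

Lemma Bergman0 : Bergman R (cst 0).
Proof.
apply: (@Bergman_dominated _ (cst 0)%E) => //; first exact: holomorphic_cst.
  by rewrite integral0 ltry.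
move=> p /plane_discP[z zE]; rewrite lee_fin /sqnorm -zE ext0E.
by rewrite (@normc0 R) expr0n.
Qed.

Lemma Bergman_sum n (a : 'I_n -> disc R -> C) : (forall i, Bergman R (a i)) ->
  Bergman R (fun z => \sum_(i < n) a i z).
Proof.
move=> Ba; rewrite (_ : (fun z => _) = \sum_(i < n) a i); last first.
  by apply/funext => z; rewrite fct_sumE.
apply: (big_ind (Bergman R)) => //; [exact: Bergman0|exact: BergmanD].
Qed.

End BergmanSpace.

(** * Kernels peaking at a boundary point of the disc *)

Section BoundaryPoint.
Variables (R : realType) (alpha : Cplx R).
Local Notation C := (Cplx R).
Local Notation Re := (@complex.Re R).
Hypothesis alpha1 : `|alpha| = 1.

Lemma derivable_affine (F : numFieldType) (f : F^o -> F^o) (a b z : F) :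
  derivable f (b - a * z) 1 -> derivable (fun w : F^o => f (b - a * w)) z 1.
Proof.
move=> /derivable1_diffP df; apply/derivable1_diffP.
apply: (@differentiable_comp _ _ _ _ (fun w : F^o => b - a * w : F^o) f) => //.
Qed.

Lemma derivable_kernel (F : numFieldType) (c v : F) : c + v != 0 ->
  derivable (fun u : F^o => c / (c + u) : F^o) v 1.
Proof.
move=> cv; apply: derivableM; first exact: derivable_cst.
by apply: derivableV => //; apply: derivableD.
Qed.

(** The coordinate that moves [alpha] to [0] and the disc into the right
    half-plane. *)
Definition gap (z : C) : C := 1 - conjc alpha * z.

Lemma normc_conj_alpha : normc (conjc alpha) = 1.
Proof.
have : `|conjc alpha| = 1 by rewrite normcJ.
by rewrite Defs.normcE => -[].
Qed.

Lemma Re_gap_gt0 (z : C) : disc R z -> 0 < Re (gap z).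
Proof.
rewrite /disc /= Defs.normcE ltcR => z1.
have -> : Re (gap z) = 1 - Re (conjc alpha * z) by rewrite /gap; case: (_ * z).
rewrite subr_gt0; apply: (le_lt_trans (ler_Re _)).
by rewrite (@normcM R) normc_conj_alpha mul1r.
Qed.

Lemma holomorphic_gap (f : C -> C) : (forall u, 0 < Re u -> derivable f u 1) ->
  holomorphic (fun z : disc R => f (gap (val z))).
Proof.
move=> fd; apply: (@holomorphic_restr _ (fun z => f (gap z))) => z zd.
by apply: derivable_affine; apply: fd; exact: Re_gap_gt0.
Qed.

Lemma Re_gap_val (z : disc R) : 0 < Re (gap (val z)).
Proof. by apply: Re_gap_gt0; have := set_mem (valP z). Qed.

Definition peak_fun (e : R) (z : disc R) : C := peak e (gap (val z)).

Lemma holomorphic_peak (e : R) : 0 <= e -> holomorphic (peak_fun e).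
Proof.
move=> e0; apply: holomorphic_gap => u u0.
by apply: derivable_kernel; exact: addc_neq0.
Qed.

Lemma Hinf_peak (e : R) : 0 < e -> peak_fun e \in Hinf R.
Proof.
move=> e0; apply/HinfP; split; first exact: holomorphic_peak (ltW e0).
by exists 1 => z; apply: peak_le1 => //; exact/ltW/Re_gap_val.
Qed.

End BoundaryPoint.

(** * Small scales and multiplication into the Bergman space *)

Section Weights.
Variables (R : realType) (alpha : Cplx R).
Local Notation C := (Cplx R).
Local Notation plane := (measurableTypeR R * measurableTypeR R)%type.
Local Notation mu := (@lebesgue_measure R \x @lebesgue_measure R)%E.
Local Notation D := (@plane_disc R).
Hypothesis alpha1 : `|alpha| = 1.
Implicit Types f g : disc R -> C.

Definition peak_weight (e : R) (p : plane) : R :=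
  normc (ext0 (peak_fun alpha e) (p.1 +i* p.2)%C).

Lemma peak_weight_ge0 e p : 0 <= peak_weight e p.
Proof. exact: normc_ge0. Qed.

Lemma measurable_peak_weight f e : holomorphic f -> 0 <= e ->
  measurable_fun D (fun p => (sqnorm f p * peak_weight e p)%:E).
Proof.
move=> hf e0; apply/measurable_EFinP; apply: measurable_funM.
  by apply/measurable_EFinP; exact: measurable_sqnorm.
exact: measurable_normc_holomorphic (holomorphic_peak alpha1 e0).
Qed.

(** Dominated convergence along the scales [1 / (n + 1)]: the kernels are bounded
    by 1 and tend to 0 at each point of the disc. *)
Lemma small_peak_weight f (eta : R) : Bergman R f -> 0 < eta ->
  exists2 e : R, 0 < e <= eta &
    (\int[mu]_(p in D) (sqnorm f p * peak_weight e p)%:E <= eta%:E)%E.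
Proof.
move=> [hf If] eta0.
have mD := @measurable_plane_disc R.
pose F n p := (sqnorm f p * peak_weight (harmonic n) p)%:E.
have h0 n : 0 < harmonic n :> R by rewrite /harmonic /= invr_gt0.
have mF n : measurable_fun D (F n) by exact: measurable_peak_weight (ltW (h0 n)).
have cF : {ae mu, forall p, D p -> F ^~ p @ \oo --> cst 0%E p}.
  apply: aeW => p /plane_discP[z zE]; apply: cvg_EFin; first by near=> n.
  rewrite /comp /=.
  have c0 : sqnorm f p * (harmonic n / normc (gap alpha (val z)))
      @[n --> \oo] --> (0 : R).
    rewrite -[X in _ --> X](mulr0 (sqnorm f p)); apply: cvgMl_tmp.
    rewrite -[X in _ --> X](mul0r (normc (gap alpha (val z)))^-1).
    by apply: cvgMr_tmp; exact: cvg_harmonic.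
  apply: (squeeze_cvgr _ (cvg_cst 0) c0); near=> n.
  rewrite mulr_ge0 ?sqr_ge0 ?peak_weight_ge0//= ler_wpM2l ?sqr_ge0//.
  rewrite /peak_weight -zE ext0E; apply: peak_le; first exact: ltW.
  exact: Re_gap_val.
have iF : mu.-integrable D (fun p => (sqnorm f p)%:E).
  apply/integrableP; split; first exact: measurable_sqnorm.
  rewrite (eq_integral (fun p => (sqnorm f p)%:E))// => p _.
  by rewrite gee0_abs// sqnorm_ge0.
have bF : {ae mu, forall p n, D p -> (`|F n p| <= (sqnorm f p)%:E)%E}.
  apply: aeW => p n /plane_discP[z zE].
  rewrite gee0_abs ?lee_fin; last by rewrite mulr_ge0 ?sqr_ge0 ?peak_weight_ge0.
  rewrite ler_piMr ?sqr_ge0// /peak_weight -zE ext0E.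
  by apply: peak_le1 => //; exact/ltW/Re_gap_val.
have [_ _] := dominated_convergence mD mF (measurable_cst 0%E) cF iF bF.
rewrite integral0 => c0.
have : \forall n \near \oo, (\int[mu]_(p in D) F n p < eta%:E)%E.
  apply: (c0 [set u | (u < eta%:E)%E]); apply: (@open_ereal_lt' _ 0%E).
  by rewrite lte_fin.
have : \forall n \near \oo, (harmonic n : R) < eta.
  by apply: (cvgr_lt 0) => //; exact: cvg_harmonic.
move=> /filterI/[apply]/filter_ex[n [he Ie]].
by exists (harmonic n); [rewrite h0 ltW|exact: ltW].
Unshelve. all: by end_near. Qed.

(** The pointwise bound [multiplier_sqr_le], multiplied by [|f|^2], integrates
    term by term to a convergent series. *)
Lemma Bergman_multiplier f (eps : nat -> R) : (forall k, 0 < eps k) ->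
  cvgn (series eps) -> Bergman R f ->
  (forall k, (2 * k + 3)%:R%:E *
     \int[mu]_(p in D) (sqnorm f p * peak_weight (eps k) p)%:E <=
     (1 / (2 ^ (k + 1))%:R)%:E)%E ->
  Bergman R (fun z => multiplier eps (gap alpha (val z)) * f z).
Proof.
move=> eps0 ceps [hf If] Ik.
have mD := @measurable_plane_disc R.
have msf := measurable_sqnorm hf.
pose t k p := ((2 * k + 3)%:R * (sqnorm f p * peak_weight (eps k) p))%:E.
have t0 k p : (0 <= t k p)%E.
  by rewrite lee_fin mulr_ge0// mulr_ge0 ?sqr_ge0 ?peak_weight_ge0.
have mt k : measurable_fun D (t k).
  rewrite /t; under eq_fun do rewrite EFinM.
  by apply: measurable_funeM; exact: (measurable_peak_weight hf (ltW (eps0 k))).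
have mst : measurable_fun D (fun p => \sum_(k <oo) t k p)%E.
  by apply: ge0_emeasurable_sum => // k p _ _; exact: t0.
have st0 p : (0 <= \sum_(k <oo) t k p)%E.
  by apply: nneseries_ge0 => k _ _; exact: t0.
have hm : holomorphic (fun z : disc R => multiplier eps (gap alpha (val z))).
  by apply: holomorphic_gap => // u u0; exact: derivable_multiplier.
apply: (@Bergman_dominated _ _
  (fun p => 4%:E * ((sqnorm f p)%:E + \sum_(k <oo) t k p))%E).
- exact: holomorphicM hm hf.
- by apply: measurable_funeM; exact: emeasurable_funD.
- rewrite ge0_integralZl//; last 2 first.
    exact: emeasurable_funD.
    by move=> p _; rewrite adde_ge0 ?sqnorm_ge0.
  rewrite ge0_integralD//; last by move=> p _; exact: sqnorm_ge0.
  apply: lte_mul_pinfty => //; apply: lte_add_pinfty => //.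
  rewrite integral_nneseries//.
  apply: (@le_lt_trans _ _ (\sum_(k <oo) (1 / (2 ^ (k + 1))%:R)%:E)%E).
    apply: lee_nneseries => k _; first by move=> _; exact: integral_ge0.
    apply: le_trans (Ik k); rewrite /t; under eq_integral do rewrite EFinM.
    rewrite ge0_integralZl//.
      by exact: (measurable_peak_weight hf (ltW (eps0 k))).
    by move=> p _; rewrite lee_fin mulr_ge0 ?sqr_ge0 ?peak_weight_ge0.
  by rewrite (cvg_lim _ (@cvg_geometric_eseries_half R 1 0))// ltry.
- move=> p /plane_discP[z zE]; rewrite /sqnorm -zE ext0E (@normcM R) exprMn.
  have h := multiplier_sqr_le eps0 ceps (Re_gap_val alpha1 z).
  rewrite mulrC EFinM.
  apply: (@le_trans _ _ ((normc (f z) ^+ 2)%:E * (4%:E *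
    (1 + \sum_(k <oo) ((2 * k + 3)%:R *
      normc (peak (eps k) (gap alpha (val z))))%:E)))%E).
    by apply: lee_wpmul2l => //; rewrite lee_fin sqr_ge0.
  rewrite muleCA; apply: lee_wpmul2l => //.
  rewrite ext0E ge0_muleDr//; last first.
    by apply: nneseries_ge0 => k _ _; rewrite lee_fin mulr_ge0 ?normc_ge0.
  rewrite mule1 leeD2l// -nneseriesZl//; last first.
    by move=> k _; rewrite lee_fin mulr_ge0 ?normc_ge0.
  apply: lee_nneseries => k _.
    move=> _; rewrite -EFinM lee_fin mulr_ge0 ?sqr_ge0//.
    by rewrite mulr_ge0 ?normc_ge0.
  by rewrite -EFinM lee_fin /sqnorm /peak_weight -zE !ext0E mulrCA.
Qed.

End Weights.

(** * Characters over a boundary point *)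

Section Character.
Variables (R : realType) (alpha : Cplx R) (phi : maximal_ideal_space R).
Local Notation C := (Cplx R).
Hypothesis alpha1 : `|alpha| = 1.
Hypothesis phi_alpha : char_pi phi = alpha.

Let phiM f g : val phi (f * g) = val phi f * val phi g.
Proof. by have [_ phiM _ _] := set_mem (valP phi); exact: phiM. Qed.

Let phi_scalar : scalar (val phi).
Proof. by have [] := set_mem (valP phi). Qed.

Lemma character0 : val phi 0 = 0.
Proof. by have := phi_scalar (-1) 0 0; rewrite scaler0 addr0 mulN1r addNr. Qed.

Lemma character1 : val phi 1 = 1.
Proof.
have [_ _ phi0 _] := set_mem (valP phi).
have [f pf] : exists f, val phi f != 0.
  apply: contra_notP phi0 => nf; apply/funext => f; apply/eqP.
  by apply: contra_notT nf => pf; exists f.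
by apply: (mulIf pf); rewrite -phiM !mul1r.
Qed.

Definition Hpeak (e : R) (e0 : 0 < e) : Hinfty R :=
  MkHinfty (Hinf_peak alpha1 e0).

Lemma conj_alphaM : conjc alpha * alpha = 1.
Proof. by rewrite mulrC -sqr_normc alpha1 expr1n. Qed.

(** The kernel times [e + u] is the constant [e], and [phi] kills [u]. *)
Lemma character_peak e (e0 : 0 < e) : val phi (Hpeak e0) = 1.
Proof.
pose u : Hinfty R := (- conjc alpha) *: Hinfty_id R + 1.
have phiu : val phi u = 0.
  by rewrite phi_scalar character1 [val phi _]phi_alpha mulNr conj_alphaM addNr.
pose d : Hinfty R := (e%:C)%C *: (1 : Hinfty R) + u.
have dE z : d z = (e%:C)%C + gap alpha (val z).
  rewrite -[LHS]/((e%:C)%C * 1 + (- conjc alpha * val z + 1)).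
  by rewrite mulr1 /gap mulNr [- _ + 1]addrC.
have Pd : Hpeak e0 * d = (e%:C)%C *: (1 : Hinfty R) + 0.
  apply/val_inj/funext => z.
  rewrite addr0 -[LHS]/(peak e (gap alpha (val z)) * d z) dE.
  by rewrite divfK ?addc_neq0 ?ltW ?Re_gap_val// -[RHS]/((e%:C)%C * 1) mulr1.
have := phiM (Hpeak e0) d.
rewrite Pd phi_scalar character0 character1 mulr1 addr0.
have -> : val phi d = (e%:C)%C by rewrite phi_scalar phiu character1 mulr1 addr0.
have ne : (e%:C)%C != 0 :> C by rewrite -[0]/(0%:C)%C (inj_eq (@complexI R)) gt_eqF.
by move=> /esym/(canRL (mulfK ne)) ->; rewrite divff.
Qed.

Lemma character_continuous0 (e : R) : 0 < e ->
  exists2 d : R, 0 < d & forall g, sup_norm g < d -> normc (val phi g) < e.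
Proof.
move=> e0; have [_ _ _ /(_ 0)] := set_mem (valP phi).
rewrite /continuous_at character0.
have e0' : 0 < (e%:C)%C :> R[i] by rewrite ltcR.
move=> /cvgrPdist_lt/(_ _ e0')/nbhs_ballP[d /= d0 Hd].
have [d1 dd] : exists d1 : R, d = (d1%:C)%C.
  by case: d d0 {Hd} => x y; rewrite ltcE /= => /andP[/eqP-> _]; exists x.
move: d0 Hd; rewrite {}dd ltcR => d0 Hd.
exists d1 => // g gd; rewrite -ltcR -Defs.normcE -normrN -sub0r; apply: Hd.
by rewrite -ball_normE /= sub0r normrN Hinfty_normE ltcR.
Qed.

(** The hypothesis says that [r] tends to 0 at [alpha]. Multiplying [r] by a
    kernel does not change its image under [phi], but makes the product uniformly
    small: near [alpha] because [r] is, elsewhere because a kernel of small scale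
    is. *)
Lemma character_eq0 (r : Hinfty R) :
  (forall eta : R, 0 < eta -> exists2 d : R, 0 < d &
     forall z : disc R, normc (gap alpha (val z)) <= d -> normc (r z) <= eta) ->
  val phi r = 0.
Proof.
move=> small; apply/eqP; apply: contraT => c0.
have nc0 : 0 < normc (val phi r : C).
  by rewrite lt_neqAle normc_ge0 andbT eq_sym; apply: contra_neq c0 => /eq0_normc.
have [d d0 Hd] := character_continuous0 nc0.
have [s s0 Hs] := small (d / 2) (divr_gt0 d0 (ltr0n _ 2)).
pose M := sup_norm r + 1; have M0 : 0 < M by rewrite ltr_wpDl// sup_norm_ge0.
(* The scale for which the kernel is at most [d / 2 / M] where [normc u > s]. *)
pose e := d / 2 * s / M.
have e0 : 0 < e by rewrite !divr_gt0// mulr_gt0// divr_gt0.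
suff : normc (val phi (r * Hpeak e0)) < normc (val phi r).
  by rewrite phiM character_peak mulr1 ltxx.
apply: Hd; apply: (@le_lt_trans _ _ (d / 2)); last by lra.
apply: sup_norm_le => z; rewrite HinftyME [normc _](@normcM R).
have u0 := Re_gap_val alpha1 z.
have [near|far] := leP (normc (gap alpha (val z))) s.
  rewrite -[leRHS]mulr1; apply: ler_pM; rewrite ?normc_ge0// ?Hs//.
  by apply: peak_le1 => //; exact: ltW.
have -> : d / 2 = M * (e / s) by rewrite /e; field; rewrite !gt_eqF.
apply: ler_pM; rewrite ?normc_ge0//.
  by apply: (le_trans (sup_norm_ub r z)); rewrite lerDl.
apply: (le_trans (peak_le (ltW e0) u0)); rewrite ler_pM2l// lef_pV2 ?posrE//.
  exact: ltW.
exact: lt_trans far.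
Qed.

End Character.

(** * Factorization *)

Section Factorization.
Variables (R : realType) (alpha : Cplx R).
Local Notation C := (Cplx R).
Local Notation Re := (@complex.Re R).
Hypothesis alpha1 : `|alpha| = 1.
Variable eps : nat -> R.
Hypothesis eps_gt0 : forall k, 0 < eps k.
Hypothesis eps_cvg : cvgn (series eps).

Definition recip_multiplier (z : disc R) : C :=
  (multiplier eps (gap alpha (val z)))^-1.

Lemma normc_multiplier_ge1 u : 0 < Re u -> 1 <= normc (multiplier eps u).
Proof.
by move=> u0; apply: le_trans (Re_multiplier_ge1 eps_gt0 eps_cvg u0) (ler_Re _).
Qed.

Lemma multiplier_neq0 u : 0 < Re u -> multiplier eps u != 0.
Proof.
move=> /normc_multiplier_ge1; apply: contraTneq => ->.
by rewrite (@normc0 R) ler10.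
Qed.

Lemma Hinf_recip_multiplier : recip_multiplier \in Hinf R.
Proof.
apply/HinfP; split.
  apply: (@holomorphic_gap _ _ alpha1 (fun u => (multiplier eps u)^-1)) => u u0.
  by apply: derivableV; [exact: multiplier_neq0|exact: derivable_multiplier].
exists 1 => z; have h := normc_multiplier_ge1 (Re_gap_val alpha1 z).
by rewrite (@normcV R) invf_le1// (lt_le_trans ltr01 h).
Qed.

(** The reciprocal of the multiplier tends to 0 at [alpha]: the first [m] scales
    have a positive lower bound [d], within which the multiplier has real part at
    least [1 + m / 4]. *)
Lemma recip_multiplier_small (eta : R) : 0 < eta -> exists2 d : R, 0 < d &
  forall z : disc R, normc (gap alpha (val z)) <= d ->
    normc (recip_multiplier z) <= eta.
Proof.
move=> eta0.
have [m mE] : exists m : nat, eta^-1 <= 1 + m%:R / 4.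
  exists (Num.bound (4 / eta)); apply: ler_wpDl => //.
  by rewrite ler_pdivlMr// mulrC; apply/ltW/archi_boundP; rewrite divr_ge0 ?ltW.
have [d d0 dm] : exists2 d, 0 < d & forall k, (k < m)%N -> d <= eps k.
  elim: m {mE} => [|m [d d0 IH]]; first by exists 1.
  exists (Num.min d (eps m)); first by rewrite lt_min d0 eps_gt0.
  move=> k; rewrite ltnS leq_eqVlt => /predU1P[->|km];
    rewrite ge_min ?lexx ?orbT//.
  by rewrite IH.
exists d => // z zd; have u0 := Re_gap_val alpha1 z.
rewrite (@normcV R) invf_ple ?posrE//.
  apply: (le_trans mE); apply: le_trans (ler_Re _).
  apply: Re_multiplier_near => // k km; exact: le_trans (dm k km).
by apply: (lt_le_trans ltr01); exact: normc_multiplier_ge1.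
Qed.

End Factorization.

Theorem theorem3p2 (R : realType) (alpha : Cplx R) (halpha : `|alpha| = 1)
    (phi : maximal_ideal_space R)
    (hphi : (@char_pi R @^-1` [set alpha]) phi) :
  ideal_mul (char_ker phi) (Bergman R) = Bergman R.
Proof.
apply/seteqP; split=> [_ [n [r [a [_ aB ->]]]]|f fB].
  by apply: Bergman_sum => i; exact: BergmanM.
(* The factor [2 ^ (k + 1)] makes both the scales and the weighted integrals
   summable; [2 * k + 3] is the weight of the [k]-th kernel in
   [multiplier_sqr_le]. *)
pose eta k : R := 1 / (2 ^ (k + 1))%:R / (2 * k + 3)%:R.
have eta0 k : 0 < eta k by rewrite !divr_gt0 ?ltr0n ?expn_gt0// addnC.
have /choice[eps epsP] k : exists e : R, 0 < e <= eta k /\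
    (\int[@lebesgue_measure R \x @lebesgue_measure R]_(p in @plane_disc R)
       (sqnorm f p * peak_weight alpha e p)%:E <= (eta k)%:E)%E.
  by have [e e1 e2] := small_peak_weight halpha fB (eta0 k); exists e.
have eps0 k : 0 < eps k by have [/andP[]] := epsP k.
have ceps : cvgn (series eps).
  apply: (@series_le_cvg _ _ (fun k => 1 / (2 ^ (k + 1))%:R)) => [k|k|k|].
  - exact: ltW.
  - by rewrite divr_ge0.
  - have [/andP[_ ek] _] := epsP k; apply: (le_trans ek).
    by rewrite /eta ler_pdivrMr ?ler_peMr ?ltr0n ?ler1n ?addnS.
  - exact: cvgP (@cvg_geometric_series_half R 1 0).
pose r : Hinfty R := MkHinfty (Hinf_recip_multiplier halpha eps0 ceps).
exists 1%N, (fun=> r), (fun _ z => multiplier eps (gap alpha (val z)) * f z).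
split=> [_|_|].
- apply: (character_eq0 halpha hphi) => e e0.
  exact: recip_multiplier_small.
- apply: Bergman_multiplier => // k.
  have [_ Ik] := epsP k.
  apply: (@le_trans _ _ ((2 * k + 3)%:R%:E * (eta k)%:E)%E).
    exact: lee_wpmul2l.
  by rewrite -EFinM lee_fin mulrC divfK// pnatr_eq0 addnS.
- apply/funext => z; rewrite big_ord1 mulrA mulVf ?mul1r//.
  by apply: multiplier_neq0 => //; exact: Re_gap_val.
Qed.
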